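(* Let $z^{(0)}\in\mathcal{Z}$, let $\gamma\in(0,\xi)$, and let $(\rho^{(i)})_{i\in\mathbb{N}}$ be a sequence in $[0,2]$ such that $\sum_{i\in\mathbb{N}}\rho^{(i)}(2-\rho^{(i)})=+\infty$. Then the sequence $(z^{(i)})_{i\in\mathbb{N}}$ defined by the forward-backward iteration $$z^{(i+\frac12)}=J_{\gamma M}\big(z^{(i)}-\gamma Cz^{(i)}\big),\qquad z^{(i+1)}=z^{(i)}+\rho^{(i)}\big(z^{(i+\frac12)}-z^{(i)}\big),\qquad i=0,1,\ldots$$ converges weakly to a solution of the monotone inclusion $0\in Mz+Cz$.
   Context: $\mathcal{Z}$ is a real Hilbert space and $M:\mathcal{Z}\to 2^{\mathcal{Z}}$ is a set-valued maximally monotone operator, with resolvent $J_{\gamma M}=(\gamma M+\mathrm{Id})^{-1}$. The operator $C:\mathcal{Z}\to\mathcal{Z}$ is affine, $Cz=Qz+c$, where $Q$ is a self-adjoint, positive (i.e. $\langle z,Qz\rangle\ge 0$ for all $z$), nonzero, bounded linear operator on $\mathcal{Z}$ and $c\in\mathcal{Z}$; $\xi=1/\|Q\|$, so that $C$ is $\xi$-cocoercive. The set of solutions $z\in\mathcal{Z}$ of $0\in Mz+Cz$ is assumed nonempty. *)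

(* Defs.v *)
From HB Require Import structures.
From mathcomp Require Import all_boot all_order all_algebra sesquilinear.
From mathcomp Require Import all_classical all_reals all_analysis.

Set Implicit Arguments.
Unset Strict Implicit.
Unset Printing Implicit Defensive.

Import Order.TTheory GRing.Theory Num.Theory.
Import numFieldNormedType.Exports.

Local Open Scope classical_set_scope.
Local Open Scope ring_scope.

HB.mixin Record NormedModule_isInnerProduct (R : realType) Z
    of NormedModule R Z := {
  inner : {dot Z for @idfun R};
  inner_normE : forall z : Z, inner z z = `|z| ^+ 2
}.

#[short(type="hilbertType")]
HB.structure Definition Hilbert (R : realType) :=
  {Z of CompleteNormedModule R Z & NormedModule_isInnerProduct R Z}.

Section operators.
Context {R : realType} {Z : hilbertType R}.

(* A set-valued operator Z -> 2^Z is a function M : Z -> set Z;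
   M z u means that (z, u) is in its graph. *)

Definition op_single (C : Z -> Z) : Z -> set Z := fun z => [set C z].

Definition op_add (M N : Z -> set Z) : Z -> set Z :=
  fun z => [set u + v | u in M z & v in N z].

Definition op_scale (g : R) (M : Z -> set Z) : Z -> set Z :=
  fun z => [set g *: u | u in M z].

Definition op_inv (M : Z -> set Z) : Z -> set Z := fun u => [set z | M z u].

Definition op_zeros (M : Z -> set Z) : set Z := [set z | M z 0].

Definition monotone_op (M : Z -> set Z) : Prop :=
  forall x y u v, M x u -> M y v -> 0 <= inner (x - y) (u - v).

Definition maximally_monotone (M : Z -> set Z) : Prop :=
  monotone_op M /\
  forall N : Z -> set Z,
    monotone_op N -> (forall z, M z `<=` N z) -> N = M.

(* The resolvent is here a set-valued operator; when M is maximally monotone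
   and g > 0, its values are singletons (Minty), and [resolvent] is the
   corresponding function. *)
Definition set_resolvent (g : R) (M : Z -> set Z) : Z -> set Z :=
  op_inv (op_add (op_scale g M) (op_single idfun)).

Definition resolvent (g : R) (M : Z -> set Z) : Z -> Z :=
  fun x => xget 0 (set_resolvent g M x).

Definition self_adjoint (Q : Z -> Z) : Prop :=
  forall x y, inner (Q x) y = inner x (Q y).

Definition positive_op (Q : Z -> Z) : Prop := forall z, 0 <= inner z (Q z).

Definition opnorm (Q : Z -> Z) : R :=
  sup [set `|Q z| | z in [set z : Z | `|z| <= 1]].

Definition weakly_converges (z : nat -> Z) (x : Z) : Prop :=
  forall y, inner (z i) y @[i --> \oo] --> inner x y.

End operators.

(* Main.v *)
Require Import Defs.
From mathcomp Require Import all_boot all_order all_algebra sesquilinear.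
From mathcomp Require Import all_classical all_reals all_analysis.
From mathcomp Require Import ring lra.

Import Order.TTheory GRing.Theory Num.Theory.
Import numFieldNormedType.Exports.

Local Open Scope classical_set_scope.
Local Open Scope ring_scope.

(** The forward-backward map [T x = J_(gM) (x - g C x)] is a proximal-point map in
a different Hilbert metric. Write [P = Id - g Q]. By definition of the
resolvent, [x - g C x - T x] lies in [g M (T x)]; since [C] is affine with linear
part [Q], adding [g C (T x)] gives
  [P (x - T x) \in g (M + C) (T x)].
As [g ||Q|| < 1], [P] is self-adjoint, bounded and coercive, so
[<x, y>_P = <x, P y>] is an equivalent inner product, and monotonicity of [M + C]
makes [T] firmly nonexpansive for it
([fb_step_firmly_nonexpansive]). The zeros of [M + C] are the fixed points of [T]
([fb_step_fixed]). Firm nonexpansiveness, rather than mere averagedness with a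
constant depending on [g], is what allows relaxation parameters up to 2.

The theorem is then the Krasnoselskii-Mann theorem in the [P]-metric
([krasnoselskii_mann]). For a fixed point [p] and the residual [D_i = z_i - T z_i],
  [|z_(i+1) - p|^2 <= |z_i - p|^2 - rho_i (2 - rho_i) |D_i|^2],
and [|D_i|] is nonincreasing. Summing and using that the weights have infinite
sum forces [D_i --> 0]. Every weak cluster point of [z] is therefore fixed by [T]
([demiclosed]), and since [|z_i - p|] converges for each fixed point [p] there is
only one cluster point ([opial]).

Two facts of Hilbert space theory carry the rest: Minty's theorem, by which the
resolvent is everywhere defined ([resolventP]), and weak compactness of bounded
sequences, stated along ultrafilters so that no subsequences are extracted
([bounded_ultra_weak_cvg]). The first is reached through the Fitzpatrick function
and the second through the Riesz representation theorem; both come from one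
minimisation principle for strongly convex functions on [Z * Z]
([strongly_convex_min]). *)

(** * Inner product spaces *)

Section inner_product.
Context {R : realType} {Z : hilbertType R}.
Implicit Types (x y z : Z) (a : R).

Lemma innerC x y : inner x y = inner y x.
Proof. by rewrite hermC /= expr0 mul1r. Qed.

Lemma innerDl x y z : inner (x + y) z = inner x z + inner y z.
Proof. exact: linearDl. Qed.

Lemma innerDr x y z : inner z (x + y) = inner z x + inner z y.
Proof. exact: linearDr. Qed.

Lemma innerNl x z : inner (- x) z = - inner x z.
Proof. exact: linearNl. Qed.

Lemma innerNr x z : inner z (- x) = - inner z x.
Proof. exact: linearNr. Qed.

Lemma innerZl a x z : inner (a *: x) z = a * inner x z.
Proof. by rewrite linearZl_LR. Qed.

Lemma innerZr a x z : inner z (a *: x) = a * inner z x.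
Proof. by rewrite linearZr_LR. Qed.

Lemma inner0l z : inner 0 z = 0.
Proof. by rewrite -(scale0r (0 : Z)) innerZl mul0r. Qed.

Lemma inner0r z : inner z 0 = 0.
Proof. by rewrite innerC inner0l. Qed.

Definition innerE :=
  (innerDl, innerDr, innerNl, innerNr, innerZl, innerZr, inner0l, inner0r).

Lemma inner_ge0 x : 0 <= inner x x.
Proof. by rewrite inner_normE sqr_ge0. Qed.

Lemma inner_le0_eq0 x : inner x x <= 0 -> x = 0.
Proof.
rewrite inner_normE => h; apply/normr0_eq0/eqP.
by rewrite -sqrf_eq0 eq_le h sqr_ge0.
Qed.

Lemma inner_le_norm x y : inner x y <= `|x| * `|y|.
Proof.
have [->|x0] := eqVneq x 0; first by rewrite inner0l normr0 mul0r.
have [->|y0] := eqVneq y 0; first by rewrite inner0r normr0 mulr0.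
have ab0 : 0 < `|x| * `|y| by rewrite mulr_gt0 ?normr_gt0.
have := inner_ge0 (`|y| *: x - `|x| *: y).
rewrite !innerE (innerC y x) !inner_normE => h.
rewrite -subr_ge0 -(pmulr_rge0 _ ab0); nra.
Qed.

Lemma cauchy_schwarz x y : `|inner x y| <= `|x| * `|y|.
Proof.
by rewrite ler_norml inner_le_norm lerNl -innerNl -(normrN x) inner_le_norm.
Qed.

Lemma inner_cvgl {T : Type} {F : set_system T} {FF : Filter F} (f : T -> Z) x y :
  f @ F --> x -> inner (f i) y @[i --> F] --> inner x y.
Proof.
move=> fx; apply/subr_cvg0.
apply: norm_cvg0.
have h0 : `|f i - x| * `|y| @[i --> F] --> 0.
  rewrite -[X in _ --> X](mul0r `|y|); apply: cvgM; last exact: cvg_cst.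
  rewrite -(normr0 Z); apply: cvg_norm.
  by rewrite -(subrr x); apply: cvgB => //; apply: cvg_cst.
apply: (squeeze_cvgr _ (cvg_cst 0) h0); near=> i.
rewrite normr_ge0 /= -innerNl -innerDl.
exact: cauchy_schwarz.
Unshelve. all: by end_near.
Qed.

Lemma inner_weak_strong_cvg0 {T : Type} {F : set_system T} {FF : Filter F}
    (f g : T -> Z) (K : R) :
  (forall i, `|f i| <= K) -> `|g i| @[i --> F] --> 0 ->
  inner (f i) (g i) @[i --> F] --> 0.
Proof.
move=> fK g0; apply: norm_cvg0.
have h0 : K * `|g i| @[i --> F] --> 0.
  by rewrite -[X in _ --> X](mulr0 K); apply: cvgM => //; apply: cvg_cst.
apply: (squeeze_cvgr _ (cvg_cst 0) h0); near=> i.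
rewrite normr_ge0 /=; apply: le_trans (cauchy_schwarz _ _) _.
exact: ler_wpM2r.
Unshelve. all: by end_near.
Qed.

End inner_product.

(** * Minimisation of strongly convex functions *)

Section variational_principle.
Context {R : realType} {Z : hilbertType R}.

Lemma hilbert_cauchy_cvg (x : nat -> Z) (K : R) :
  (forall n k, inner (x n - x k) (x n - x k) <= K * (n.+1%:R^-1 + k.+1%:R^-1)) ->
  exists l : Z, x @ \oo --> l.
Proof.
move=> xK; suff : cvg (x @ \oo) by move=> h; exists (lim (x @ \oo)).
apply/cauchy_cvgP/cauchy_exP => e e0.
have K1 : 0 < `|K| + 1 by rewrite ltr_wpDl.
have e2 : 0 < e ^+ 2 / (2 * (`|K| + 1)) by rewrite divr_gt0 ?exprn_gt0 ?mulr_gt0.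
have [N _ /(_ N (leqnn N))/= hN] := near_infty_natSinv_lt (PosNum e2).
exists (x N), N => // n /= Nn.
rewrite -ball_normE /= -(@ltr_pXn2r _ 2) ?nnegrE ?(ltW e0) // -inner_normE.
apply: le_lt_trans (xK _ _) _.
have nN : n.+1%:R^-1 <= N.+1%:R^-1 :> R by rewrite lef_pV2 ?posrE // ler_nat.
have n0 : 0 <= n.+1%:R^-1 :> R by rewrite invr_ge0.
have {}hN : N.+1%:R^-1 * (2 * (`|K| + 1)) < e ^+ 2.
  by rewrite -ltr_pdivlMr ?mulr_gt0.
apply: le_lt_trans hN.
apply: (@le_trans _ _ ((`|K| + 1) * (N.+1%:R^-1 + n.+1%:R^-1))).
  by rewrite ler_wpM2r ?addr_ge0 ?invr_ge0// ler_wpDr// ler_norm.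
have -> : N.+1%:R^-1 * (2 * (`|K| + 1)) = (`|K| + 1) * (2 * N.+1%:R^-1) :> R by ring.
by rewrite ler_wpM2l ?(ltW K1) // mulr_natl mulr2n lerD2l.
Qed.

(** [E] is the epigraph, closed and convex, of a function [f] on [Z * Z]; working with
epigraphs lets [f] take the value +oo. The function
[f (x, u) + (|x|^2 + |u|^2) / 2] is strongly convex, so by the parallelogram
identity its minimising sequences are Cauchy. The conclusion is the optimality
condition at the minimiser: [- (x0, u0)] is a subgradient of [f] there. *)
Lemma strongly_convex_min (E : Z -> Z -> R -> Prop) (m : R) :
  (exists x u t, E x u t) ->
  (forall (a : R) x u t x' u' t', 0 <= a <= 1 -> E x u t -> E x' u' t' ->
    E (x + a *: (x' - x)) (u + a *: (u' - u)) (t + a * (t' - t))) ->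
  (forall (x_ u_ : nat -> Z) (t_ : nat -> R) (x u : Z) (t : R),
    (forall n, E (x_ n) (u_ n) (t_ n)) ->
    x_ @ \oo --> x -> u_ @ \oo --> u -> t_ @ \oo --> t -> E x u t) ->
  (forall x u t, E x u t -> m <= t + (inner x x + inner u u) / 2) ->
  exists x0 u0 t0, E x0 u0 t0 /\
    forall x u t, E x u t -> 0 <= t - t0 + inner x0 (x - x0) + inner u0 (u - u0).
Proof.
move=> [x1 [u1 [t1 E1]]] Econv Eclosed Ebd.
pose J (x u : Z) (t : R) : R := t + (inner x x + inner u u) / 2.
pose V := [set s | exists x u t, E x u t /\ s = J x u t].
have Vinf : has_inf V.
  split; first by exists (J x1 u1 t1), x1, u1, t1.
  by exists m => _ [x [u [t [h ->]]]]; apply: Ebd.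
have Jmin x u t : E x u t -> inf V <= J x u t.
  by move=> h; apply: ge_inf; [case: Vinf|exists x, u, t].
have /choice[p pP] (n : nat) : exists p : Z * Z * R,
    E p.1.1 p.1.2 p.2 /\ J p.1.1 p.1.2 p.2 < inf V + n.+1%:R^-1.
  have n0 : 0 < n.+1%:R^-1 :> R by rewrite invr_gt0.
  have [_ [x [u [t [h ->]]]] hlt] := inf_adherent n0 Vinf.
  by exists (x, u, t).
pose x_ n := (p n).1.1; pose u_ n := (p n).1.2; pose t_ n := (p n).2.
have Ep n : E (x_ n) (u_ n) (t_ n) by case: (pP n).
have Jp n : J (x_ n) (u_ n) (t_ n) < inf V + n.+1%:R^-1 by case: (pP n).
(* Comparing the infimum with J at the midpoint of two almost-minimisers. *)
have gap n k : inner (x_ n - x_ k) (x_ n - x_ k)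
    + inner (u_ n - u_ k) (u_ n - u_ k) <= 4 * (n.+1%:R^-1 + k.+1%:R^-1).
  have half : 0 <= (2^-1 : R) <= 1 by lra.
  have := Jmin _ _ _ (Econv _ _ _ _ _ _ _ half (Ep n) (Ep k)).
  have := Jp n; have := Jp k; rewrite /J.
  rewrite !innerE (innerC (x_ k) (x_ n)) (innerC (u_ k) (u_ n)).
  move: (n.+1%:R^-1) (k.+1%:R^-1) => a b. lra.
have [x0 xx0] : exists l : Z, x_ @ \oo --> l.
  apply: (hilbert_cauchy_cvg x_ 4) => n k.
  by apply: le_trans (gap n k); rewrite lerDl inner_ge0.
have [u0 uu0] : exists l : Z, u_ @ \oo --> l.
  apply: (hilbert_cauchy_cvg u_ 4) => n k.
  by apply: le_trans (gap n k); rewrite lerDr inner_ge0.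
have Jcvg : J (x_ n) (u_ n) (t_ n) @[n --> \oo] --> inf V.
  have h : inf V + n.+1%:R^-1 @[n --> \oo] --> inf V.
    rewrite -[X in _ --> X]addr0; apply: cvgD; first exact: cvg_cst.
    exact: cvg_harmonic.
  apply: (squeeze_cvgr _ (cvg_cst (inf V)) h); near=> n.
  by rewrite Jmin //= ltW.
have innersq (y_ : nat -> Z) y : y_ @ \oo --> y ->
    inner (y_ n) (y_ n) @[n --> \oo] --> inner y y.
  move=> h; rewrite inner_normE; under eq_fun do rewrite inner_normE.
  by rewrite !expr2; under eq_fun do rewrite expr2; apply: cvgM; apply: cvg_norm.
pose t0 := inf V - (inner x0 x0 + inner u0 u0) / 2.
have tt0 : t_ @ \oo --> t0.
  have -> : t_ = (fun n => J (x_ n) (u_ n) (t_ n)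
      - (inner (x_ n) (x_ n) + inner (u_ n) (u_ n)) / 2).
    by apply/funext => n; rewrite /J addrK.
  apply: cvgB => //; apply: cvgM; last exact: cvg_cst.
  by apply: cvgD; apply: innersq.
have E0 := Eclosed _ _ _ _ _ _ Ep xx0 uu0 tt0.
exists x0, u0, t0; split=> // x u t Ext; rewrite leNgt; apply/negP => A0.
set A := (X in X < 0) in A0.
pose B := inner (x - x0) (x - x0) + inner (u - u0) (u - u0).
have B0 : 0 <= B by rewrite addr_ge0 ?inner_ge0.
have BA : 0 < B - A by lra.
(* At parameter s of the segment towards (x, u, t), J exceeds its infimum by
   s A + s^2 B / 2; the following s makes this negative. *)
pose s := - A / (B - A).
have s01 : 0 <= s <= 1.
  by rewrite /s ler_pdivrMr // divr_ge0 ?mul1r; lra.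
have := Jmin _ _ _ (Econv _ _ _ _ _ _ _ s01 E0 Ext).
have -> : J (x0 + s *: (x - x0)) (u0 + s *: (u - u0)) (t0 + s * (t - t0))
    = inf V + (s * A + s ^+ 2 * B / 2).
  by rewrite /J /A /B /t0 !innerE (innerC x x0) (innerC u u0); field.
rewrite lerDl leNgt => /negP; apply.
have -> : s * A + s ^+ 2 * B / 2 = - (A ^+ 2 * (B - 2 * A) / (2 * (B - A) ^+ 2)).
  by rewrite /s; field; lra.
have A2 : 0 < A ^+ 2 by rewrite exprn_even_gt0 //= lt_eqF.
rewrite oppr_lt0 divr_gt0 // mulr_gt0 //; first by lra.
exact: exprn_gt0.
Unshelve. all: by end_near.
Qed.

End variational_principle.

(** * The Riesz representation theorem *)

Section riesz.
Context {R : realType} {Z : hilbertType R}.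

(** The representing vector minimises [|x|^2 / 2 - l x]. The second variable of the
minimisation principle is a dummy, whose optimal value is 0. *)
Lemma riesz_representation (l : Z -> R) (K : R) :
  scalar l -> (forall x, `|l x| <= K * `|x|) ->
  exists x0, forall y, l y = inner x0 y.
Proof.
move=> llin lK.
have lD x y : l (x + y) = l x + l y by rewrite -[x in l (x + _)]scale1r llin mul1r.
have l0 : l 0 = 0.
  by apply/normr0_eq0/eqP; rewrite eq_le normr_ge0 (le_trans (lK 0)) ?normr0 ?mulr0.
have lZ a x : l (a *: x) = a * l x by rewrite -[a *: x]addr0 llin l0 addr0.
have lB x y : l (x - y) = l x - l y by rewrite -scaleN1r lD lZ mulN1r.
have [|||x u t h|x0 [u0 [t0 [E0 opt]]]] :=
    @strongly_convex_min R Z (fun x u t => - l x <= t) (- (K ^+ 2 / 2)).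
- by exists 0, 0, 0; rewrite l0 oppr0.
- move=> a x u t x' u' t' a01 h h'; rewrite lD lZ lB.
  by have := mulr_ge0; nra.
- move=> x_ u_ t_ x u t h xx _ tt.
  have lx : - l (x_ n) @[n --> \oo] --> - l x.
    apply: cvgN; apply/subr_cvg0; apply: norm_cvg0.
    have h0 : K * `|x_ n - x| @[n --> \oo] --> 0.
      rewrite -[X in _ --> X](mulr0 K); apply: cvgM; first exact: cvg_cst.
      rewrite -(normr0 Z); apply: cvg_norm.
      by rewrite -(subrr x); apply: cvgB => //; apply: cvg_cst.
    apply: (squeeze_cvgr _ (cvg_cst 0) h0); near=> n.
    by rewrite normr_ge0 /= -lB.
  by apply: (ler_cvg_to lx tt); apply: nearW.
- have lx : l x <= K * `|x| := le_trans (ler_norm _) (lK x).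
  rewrite !inner_normE; have := sqr_ge0 (K - `|x|); have := sqr_ge0 `|u|; nra.
have main h : l h <= inner x0 h.
  have := opt (x0 + h) u0 (- l (x0 + h)) (lexx _).
  rewrite subrr inner0r addr0 (addrC x0) addrK lD.
  by move: E0; lra.
exists x0 => y; apply/eqP; rewrite eq_le main /=.
by have := main (- y); rewrite -sub0r lB l0 sub0r innerE; lra.
Unshelve. all: by end_near.
Qed.

End riesz.

(** * Minty's theorem *)

Section minty.
Context {R : realType} {Z : hilbertType R}.
Implicit Types M : Z -> set Z.

Definition monotonically_related M (x u : Z) : Prop :=
  forall y v, M y v -> 0 <= inner (x - y) (u - v).

(** Adding a monotonically related pair to the graph keeps it monotone, so maximality
forces the pair to be there already. *)
Lemma maximally_monotone_mem M x u :
  maximally_monotone M -> monotonically_related M x u -> M x u.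
Proof.
move=> [Mmon Mmax] xu.
pose N : Z -> set Z := fun z => [set v | M z v \/ (z = x /\ v = u)].
rewrite -(Mmax N); first by right.
- move=> a b c d [Mac|[-> ->]] [Mbd|[-> ->]]; first exact: Mmon.
  + by rewrite -(opprB x a) -(opprB u c) innerNl innerNr opprK xu.
  + exact: xu.
  + by rewrite subrr inner0l.
- by move=> z v; left.
Qed.

(** [E] is the epigraph of the Fitzpatrick function of [M],
[F (x, u) = sup (<x, v> + <y, u> - <y, v>)] over the graph points [(y, v)].
Maximality gives [F (x, u) >= <x, u>] and monotonicity gives equality on the
graph. At the minimiser [(x0, u0)] of [F + (|x|^2 + |u|^2) / 2], the optimality
condition tested on the graph says that [(- u0, - x0)] is monotonically related to
[M], hence belongs to it, and then that [x0 + u0 = 0]. The maximality hypothesis is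
pointwise, which makes it stable under the change of variables of [resolventP]. *)
Lemma minty_zero M :
  monotone_op M -> (forall x u, monotonically_related M x u -> M x u) ->
  exists x, M x (- x).
Proof.
move=> Mmon Mmax.
pose E x u (t : R) := forall y v, M y v -> inner x v + inner y u - inner y v <= t.
have E_ge x u t : E x u t -> inner x u <= t.
  move=> h; rewrite leNgt; apply/negP => lt_t.
  have Mxu : M x u.
    apply: Mmax => y v Myv; have := h y v Myv; rewrite !innerE; lra.
  by have := h x u Mxu; lra.
have E_graph y v : M y v -> E y v (inner y v).
  move=> Myv y' v' Myv'; have := Mmon _ _ _ _ Myv Myv'; rewrite !innerE; lra.
have [|||x u t h|x0 [u0 [t0 [E0 opt]]]] := @strongly_convex_min R Z E 0.
- have [[y [v Myv]]|noM] := pselect (exists y v, M y v).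
    by exists y, v, (inner y v); apply: E_graph.
  by exists 0, 0, 0 => y v Myv; exfalso; apply: noM; exists y, v.
- move=> a x u t x' u' t' a01 h h' y v Myv.
  have := h y v Myv; have := h' y v Myv; rewrite !innerE.
  move: (inner x v) (inner y u) (inner x' v) (inner y u') (inner y v) => p q p' q' s.
  by move=> *; nra.
- move=> x_ u_ t_ x u t h xx uu tt y v Myv.
  have lim : inner (x_ n) v + inner y (u_ n) - inner y v @[n --> \oo] -->
      inner x v + inner y u - inner y v.
    apply: cvgB; last exact: cvg_cst.
    apply: cvgD; first exact: inner_cvgl.
    by rewrite innerC; under eq_fun do rewrite innerC; apply: inner_cvgl.
  by apply: (ler_cvg_to lim tt); apply: nearW => n; apply: h.
- have := E_ge _ _ _ h; have := inner_ge0 (x + u).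
  by rewrite !innerE (innerC u x); lra.
have key y v : M y v -> inner (x0 + u0) (x0 + u0) <= inner (- u0 - y) (- x0 - v).
  move=> Myv; have := opt _ _ _ (E_graph _ _ Myv); have := E_ge _ _ _ E0.
  rewrite !innerE (innerC u0 x0) (innerC y x0); lra.
have M0 : M (- u0) (- x0).
  by apply: Mmax => y v /key; apply: le_trans; apply: inner_ge0.
have : x0 + u0 = 0.
  by apply: inner_le0_eq0; apply: le_trans (key _ _ M0) _; rewrite subrr inner0l.
by move=> /eqP; rewrite addr_eq0 => /eqP x0u0; exists x0; rewrite {1}x0u0.
Qed.

(** Minty's theorem for the operator [y |-> g M y - w], whose zeros after adding the
identity are the points of the resolvent at [w]. *)
Lemma resolventP M (g : R) (w : Z) : maximally_monotone M -> 0 < g ->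
  exists2 u, M (resolvent g M w) u & g *: u + resolvent g M w = w.
Proof.
move=> Mmax g0.
suff : exists x, set_resolvent g M w x.
  by move=> /(xgetPex 0) [_ [u Mu <-] [_ -> e]]; exists u.
pose N : Z -> set Z := fun y => [set v | M y (g^-1 *: (v + w))].
have [|x u h|x] := @minty_zero N.
- move=> x y u v hu hv; have := Mmax.1 _ _ _ _ hu hv.
  rewrite -scalerBr innerZr pmulr_rge0 ?invr_gt0 //.
  by rewrite opprD addrACA subrr addr0.
- apply: (maximally_monotone_mem _ _ _ Mmax) => y v Myv.
  have := h y (g *: v - w); rewrite /N /= subrK scalerA mulVf ?gt_eqF // scale1r.
  move=> /(_ Myv); rewrite -[v in _ -> 0 <= inner _ (_ - v)](scale1r v).
  rewrite -(mulVf (lt0r_neq0 g0)) -scalerA -scalerBr innerZr pmulr_rge0 ?invr_gt0 //.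
  by rewrite opprB addrA.
rewrite /N /= => Mx; exists x.
exists (g *: (g^-1 *: (- x + w))); first by exists (g^-1 *: (- x + w)).
by exists x => //; rewrite scalerA mulfV ?gt_eqF // scale1r addrC addrA subrr add0r.
Qed.

End minty.

(** * Weak compactness along ultrafilters *)

Section weak_compactness.

Lemma ultra_fmap (T S : Type) (f : T -> S) (U : set_system T) :
  UltraFilter U -> UltraFilter (f @ U).
Proof.
move=> UU; split=> [|G PG sUG]; first exact: fmap_proper_filter.
apply/seteqP; split=> // B GB.
have [//|UB] := in_ultra_setVsetC (f @^-1` B) UU.
have /filter_ex[s []] : G (B `&` ~` B) by apply: filterI => //; apply: sUG.
by [].
Qed.

(** If [F] misses the preimage of a neighbourhood of [l], the complement of this
preimage can be added to [F], and no ultrafilter above the result has image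
converging to [l]. *)
Lemma cvg_along_ultra (T : Type) (S : topologicalType) (f : T -> S)
    (F : set_system T) (l : S) : Filter F ->
  (forall U, UltraFilter U -> F `<=` U -> f @ U --> l) -> f @ F --> l.
Proof.
move=> FF h B Bl; have [//|nFB] := pselect (F (f @^-1` B)).
have PW : ProperFilter (within (~` (f @^-1` B)) F).
  apply: Build_ProperFilter_ex => P; rewrite /within /= => FP.
  have [//|nP] := pselect (exists x, P x); exfalso; apply: nFB.
  apply: filterS FP => x /= Px; apply: contrapT => nB.
  by apply: nP; exists x; apply: Px.
have [U [UU sU]] := ultraFilterLemma PW.
have UB : U (~` (f @^-1` B)) by apply: sU; rewrite /within /=; apply: nearW.
have UB' : U (f @^-1` B) by apply: h => // P FP; apply: sU; apply: filterS FP.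
have /filter_ex[x []] : U (f @^-1` B `&` ~` (f @^-1` B)) by apply: filterI.
by [].
Qed.

Lemma bounded_ultra_cvg (R : realType) (T : Type) (f : T -> R) (K : R)
    (U : set_system T) : UltraFilter U -> (forall i, `|f i| <= K) ->
  exists l : R, f @ U --> l.
Proof.
move=> UU fK; have := @segment_compact R (- K) K; rewrite compact_ultra.
move=> /(_ (f @ U) (ultra_fmap _ _ _ _ UU)) []; last by move=> l [_ fl]; exists l.
by apply: nearW => i /=; rewrite in_itv /= -ler_norml.
Qed.

(** The limits of [<z i, y>] along the ultrafilter form a bounded linear functional of
[y], and [x] is its Riesz representative. *)
Lemma bounded_ultra_weak_cvg (R : realType) (Z : hilbertType R)
    (z : nat -> Z) (K : R) (U : set_system nat) :
  UltraFilter U -> (forall i, `|z i| <= K) ->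
  exists x, forall y, inner (z i) y @[i --> U] --> inner x y.
Proof.
move=> UU zK.
have zyK y i : `|inner (z i) y| <= K * `|y|.
  by apply: le_trans (cauchy_schwarz _ _) _; apply: ler_wpM2r.
have /choice[l lP] y : exists l : R, inner (z i) y @[i --> U] --> l.
  exact: bounded_ultra_cvg UU (zyK y).
have [a x y|x|x0 hx0] := @riesz_representation R Z l K.
- have h : inner (z i) (a *: x + y) @[i --> U] --> a * l x + l y.
    under eq_fun do rewrite innerDr innerZr.
    by apply: cvgD => //; apply: cvgM => //; apply: cvg_cst.
  exact: (cvg_unique (@Rhausdorff R) (lP _) h).
- have /cvg_norm h := lP x.
  by apply: (ler_cvg_to h (cvg_cst (K * `|x|))); apply: nearW.
by exists x0 => y; rewrite -hx0.
Qed.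

End weak_compactness.

(** * The Krasnoselskii-Mann iteration in an operator metric *)

(** For a nonincreasing [d], [d_N (w_0 + ... + w_(N-1))] is at most the weighted sum,
hence bounded, while the second factor is unbounded. *)
Lemma weighted_sum_cvg0 {R : realType} (w d : nat -> R) (c : R) :
  (\sum_(0 <= i <oo) (w i)%:E = +oo)%E ->
  (forall i, 0 <= w i) -> (forall i, 0 <= d i) -> (forall i, d i.+1 <= d i) ->
  (forall n, \sum_(0 <= i < n) w i * d i <= c) ->
  d @ \oo --> 0.
Proof.
move=> wsum w0 d0 dle wd.
have dmono n m : (n <= m)%N -> d m <= d n by have /nonincreasing_seqP := dle; apply.
apply/cvgrPdist_le => e e0.
have [N hN] : exists N, c < e * \sum_(0 <= i < N) w i.
  apply: contrapT => noN.
  have bnd n : \sum_(0 <= i < n) w i <= c / e.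
    rewrite ler_pdivlMr // mulrC leNgt; apply/negP => h; apply: noN; by exists n.
  have : (\sum_(0 <= i <oo) (w i)%:E <= (c / e)%:E)%E.
    apply: lime_le; first by apply: is_cvg_nneseries => n _ _; rewrite lee_fin.
    by apply: nearW => n; rewrite sumEFin lee_fin.
  by rewrite wsum leye_eq.
exists N => // n /= Nn; rewrite sub0r normrN ger0_norm //.
apply: le_trans (dmono _ _ Nn) _; rewrite leNgt; apply/negP => eN.
have := le_lt_trans (wd N) hN; apply/negP; rewrite -leNgt mulr_sumr.
rewrite !big_mkord; apply: ler_sum => i _; rewrite mulrC ler_wpM2l //.
by apply: le_trans (ltW eN) _; apply: dmono; apply: ltnW.
Qed.

Section krasnoselskii_mann.
Context {R : realType} {Z : hilbertType R} (P : {linear Z -> Z}).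

(** The squared norm of the inner product [<x, P y>]. *)
Definition sqnorm_of (x : Z) : R := inner x (P x).

Definition firmly_nonexpansive_of (T : Z -> Z) : Prop :=
  forall x y, 0 <= inner (T x - T y) (P ((x - T x) - (y - T y))).

Definition coercive (a : R) : Prop :=
  0 < a /\ forall x, a * `|x| ^+ 2 <= sqnorm_of x.

Lemma self_adjoint_innerC x y :
  self_adjoint P -> inner x (P y) = inner y (P x).
Proof. by move=> Psa; rewrite -Psa innerC. Qed.

Lemma coercive_sqnorm_ge0 (a : R) x : coercive a -> 0 <= sqnorm_of x.
Proof.
by move=> [a0 h]; apply: le_trans (h x); rewrite mulr_ge0 ?sqr_ge0 // ltW.
Qed.

Lemma coercive_sqnorm_le0_eq0 (a : R) x : coercive a -> sqnorm_of x <= 0 -> x = 0.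
Proof.
move=> [a0 h] x0; apply: inner_le0_eq0; rewrite inner_normE.
by rewrite -(pmulr_rle0 _ a0); apply: le_trans (h x) _.
Qed.

Lemma coercive_cvg0 {T : Type} {F : set_system T} {FF : Filter F}
    (a : R) (f : T -> Z) :
  coercive a ->
  sqnorm_of (f i) @[i --> F] --> 0 -> `|f i| @[i --> F] --> 0.
Proof.
move=> [a0 h] q0.
have sq0 : `|f i| ^+ 2 @[i --> F] --> 0.
  have h0 : a^-1 * sqnorm_of (f i) @[i --> F] --> 0.
    by rewrite -[X in _ --> X](mulr0 a^-1); apply: cvgM => //; apply: cvg_cst.
  apply: (squeeze_cvgr _ (cvg_cst 0) h0); near=> i.
  by rewrite sqr_ge0 /= ler_pdivlMl.
have := cvg_comp _ _ sq0 (@sqrt_continuous R 0).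
rewrite sqrtr0; apply: cvg_trans; apply: near_eq_cvg; near=> i => /=.
by rewrite sqrtr_sqr normr_id.
Unshelve. all: by end_near.
Qed.

(** Firm nonexpansiveness between [z i] and [x] pairs a weakly convergent factor
[T (z i) - T x] with a strongly convergent one, so it passes to the limit, where it
reads [- |x - T x|^2 >= 0] in the [P]-metric. *)
Lemma demiclosed {U : set_system nat} {UF : ProperFilter U}
    (a B K : R) (T : Z -> Z) (z : nat -> Z) (x : Z) :
  self_adjoint P -> coercive a ->
  (forall x, `|P x| <= B * `|x|) -> firmly_nonexpansive_of T ->
  (forall i, `|z i| <= K) ->
  (forall y, inner (z i) y @[i --> U] --> inner x y) ->
  sqnorm_of (z i - T (z i)) @[i --> U] --> 0 -> T x = x.
Proof.
move=> Psa Pco PB Tfirm zK zx D0.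
have nD0 : `|z i - T (z i)| @[i --> U] --> 0.
  exact: coercive_cvg0 Pco D0.
have nPD0 : `|P (z i - T (z i))| @[i --> U] --> 0.
  have h0 : B * `|z i - T (z i)| @[i --> U] --> 0.
    by rewrite -[X in _ --> X](mulr0 B); apply: cvgM => //; apply: cvg_cst.
  apply: (squeeze_cvgr _ (cvg_cst 0) h0); near=> i.
  by rewrite normr_ge0 /=.
pose v := P (x - T x).
have lim : inner (z i) (P (z i - T (z i))) - sqnorm_of (z i - T (z i))
     - inner (T x) (P (z i - T (z i)))
     - (inner (z i) v - inner v (z i - T (z i)) - inner (T x) v) @[i --> U]
   --> 0 - 0 - 0 - (inner x v - 0 - inner (T x) v).
  have lim1 : inner (z i) (P (z i - T (z i))) @[i --> U] --> 0.
    exact: (inner_weak_strong_cvg0 _ _ _ zK nPD0).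
  have lim2 : inner (T x) (P (z i - T (z i))) @[i --> U] --> 0.
    exact: (inner_weak_strong_cvg0 _ _ _ (fun=> lexx `|T x|) nPD0).
  have lim3 : inner v (z i - T (z i)) @[i --> U] --> 0.
    exact: (inner_weak_strong_cvg0 _ _ _ (fun=> lexx `|v|) nD0).
  have lim4 : inner (T x) v @[i --> U] --> inner (T x) v by exact: cvg_cst.
  exact: (cvgB (cvgB (cvgB lim1 D0) lim2) (cvgB (cvgB (zx v) lim3) lim4)).
have : 0 <= 0 - 0 - 0 - (inner x v - 0 - inner (T x) v).
  apply: (ler_cvg_to (cvg_cst 0) lim); apply: nearW => i.
  have := Tfirm (z i) x; have Tz : T (z i) = z i - (z i - T (z i)) by rewrite subKr.
  rewrite {1}Tz (linearB P) -/v /sqnorm_of; move: (z i - T (z i)) => D.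
  by rewrite !innerE (innerC v); lra.
rewrite !subr0 sub0r oppr_ge0 -innerNl -innerDl.
move=> /(coercive_sqnorm_le0_eq0 _ _ Pco) /eqP; rewrite subr_eq0 => /eqP.
by [].
Unshelve. all: by end_near.
Qed.

(** If [x] and [x'] are weak limits of [z] along two ultrafilters, the difference
[|z i - x|^2 - |z i - x'|^2] converges and is affine in [z i]; so
[<z i, P (x - x')>] converges, and its values [<x, P (x - x')>] and
[<x', P (x - x')>] along the two ultrafilters coincide. Coercivity gives [x = x']. *)
Lemma opial (a K : R) (S : Z -> Prop) (z : nat -> Z) :
  self_adjoint P -> coercive a -> (forall i, `|z i| <= K) ->
  (forall p, S p -> exists l : R, sqnorm_of (z i - p) @[i --> \oo] --> l) ->
  (forall U x, UltraFilter U -> \oo `<=` U ->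
    (forall y, inner (z i) y @[i --> U] --> inner x y) -> S x) ->
  exists2 x, S x & weakly_converges z x.
Proof.
move=> Psa Pco zK cvgS limS.
have uniq U U' x x' : UltraFilter U -> UltraFilter U' ->
    \oo `<=` U -> \oo `<=` U' ->
    (forall y, inner (z i) y @[i --> U] --> inner x y) ->
    (forall y, inner (z i) y @[i --> U'] --> inner x' y) -> x = x'.
  move=> UU UU' sU sU' zx zx'.
  have [l hl] := cvgS _ (limS _ _ UU sU zx).
  have [l' hl'] := cvgS _ (limS _ _ UU' sU' zx').
  pose c := 2^-1 * (sqnorm_of x - sqnorm_of x' - (l - l')).
  have zc : inner (z i) (P (x - x')) @[i --> \oo] --> c.
    have -> : (fun i => inner (z i) (P (x - x'))) =
        (fun i => 2^-1 * (sqnorm_of x - sqnorm_of x'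
          - (sqnorm_of (z i - x) - sqnorm_of (z i - x')))).
      apply/funext => i; rewrite /sqnorm_of !(linearB P) !innerE.
      by rewrite (self_adjoint_innerC x (z i)) // (self_adjoint_innerC x' (z i)) //; field.
    apply: cvgM; first exact: cvg_cst.
    by apply: cvgB; [exact: cvg_cst|apply: cvgB].
  have e1 : inner x (P (x - x')) = c.
    by apply: (cvg_unique (@Rhausdorff R) (zx _)) => B /zc; apply: sU.
  have e2 : inner x' (P (x - x')) = c.
    by apply: (cvg_unique (@Rhausdorff R) (zx' _)) => B /zc; apply: sU'.
  apply/eqP; rewrite -subr_eq0; apply/eqP/(coercive_sqnorm_le0_eq0 _ _ Pco).
  by rewrite /sqnorm_of innerDl innerNl e1 e2 subrr.
have [U [UU sU]] := ultraFilterLemma eventually_filter.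
have [x zx] := bounded_ultra_weak_cvg _ _ _ _ _ UU zK.
exists x; first exact: limS UU sU zx.
move=> y; apply: cvg_along_ultra => V UV sV.
have [x' zx'] := bounded_ultra_weak_cvg _ _ _ _ _ UV zK.
by rewrite (uniq _ _ _ _ UU UV sU sV zx zx').
Qed.

(** Firm nonexpansiveness against a fixed point gives the Fejer inequality [fejer];
between consecutive iterates it gives the decrease of the residuals. *)
Lemma krasnoselskii_mann (a B : R) (T : Z -> Z) (rho : nat -> R) (z : nat -> Z) :
  self_adjoint P -> coercive a -> (forall x, `|P x| <= B * `|x|) ->
  firmly_nonexpansive_of T -> (exists p, T p = p) ->
  (forall i, 0 <= rho i <= 2) ->
  (\sum_(0 <= i <oo) (rho i * (2 - rho i))%:E = +oo)%E ->
  (forall i, z i.+1 = z i + rho i *: (T (z i) - z i)) ->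
  exists2 x, T x = x & weakly_converges z x.
Proof.
move=> Psa Pco PB Tfirm [p Tp] rho02 rhosum hz.
pose D i := z i - T (z i).
have PC x y : inner x (P y) = inner y (P x) by exact: self_adjoint_innerC.
have hz' i : z i.+1 = z i - rho i *: D i by rewrite hz /D -scalerN opprB.
have w0 i : 0 <= rho i * (2 - rho i).
  by have /andP[? ?] := rho02 i; rewrite mulr_ge0 // subr_ge0.
have fejer q i : T q = q -> sqnorm_of (z i.+1 - q)
    <= sqnorm_of (z i - q) - rho i * (2 - rho i) * sqnorm_of (D i).
  move=> Tq; have /andP[r0 _] := rho02 i.
  have := Tfirm (z i) q; rewrite Tq subrr subr0 -/(D i).
  rewrite -[T (z i)](subKr (z i)) -/(D i) (addrAC (z i)) innerDl innerNl.
  rewrite hz' (addrAC (z i)) /sqnorm_of; move: (z i - q) (D i) => u e.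
  rewrite (linearB P) (linearZ_LR P) !innerE (PC e u); nra.
have Ddecr i : sqnorm_of (D i.+1) <= sqnorm_of (D i).
  have /andP[r0 r2] := rho02 i.
  have [rz|rn] := eqVneq (rho i) 0; first by rewrite /D hz' rz scale0r subr0.
  have rp : 0 < rho i by rewrite lt_neqAle eq_sym rn.
  (* With d = D i and e = D i - D i.+1 this reads |e|^2 <= rho i <d, e>, so that
     <d, e> >= 0 and, as rho i <= 2, |e|^2 <= 2 <d, e>, i.e. |d - e| <= |d|. *)
  have : 0 <= inner (rho i *: D i - (D i - D i.+1)) (P (D i - D i.+1)).
    have -> : rho i *: D i - (D i - D i.+1) = T (z i) - T (z i.+1).
      have -> : rho i *: D i = z i - z i.+1 by rewrite hz' subKr.
      have -> : D i - D i.+1 = (z i - z i.+1) - (T (z i) - T (z i.+1)).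
        by rewrite /D !opprD addrACA.
      by rewrite subKr.
    exact: Tfirm.
  have -> : sqnorm_of (D i.+1) = sqnorm_of (D i - (D i - D i.+1)) by rewrite subKr.
  move: (D i) (D i - D i.+1) => d e; rewrite innerDl innerNl innerZl => h.
  have e0 : 0 <= sqnorm_of e := coercive_sqnorm_ge0 _ e Pco.
  rewrite /sqnorm_of in e0 *; rewrite (linearB P) !innerE (PC e d).
  have de0 : 0 <= inner d (P e) by rewrite -(pmulr_rge0 _ rp); lra.
  nra.
have bnd q i : T q = q -> sqnorm_of (z i - q) <= sqnorm_of (z 0%N - q).
  move=> Tq; elim: i => [//|i IH]; apply: le_trans (fejer q i Tq) (le_trans _ IH).
  by rewrite lerBlDr lerDl mulr_ge0 // (coercive_sqnorm_ge0 _ _ Pco).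
have Dcvg : sqnorm_of (D i) @[i --> \oo] --> 0.
  apply: (weighted_sum_cvg0 _ _ (sqnorm_of (z 0%N - p)) rhosum w0) => // [i|n].
    exact: coercive_sqnorm_ge0 Pco.
  suff : \sum_(0 <= i < n) rho i * (2 - rho i) * sqnorm_of (D i)
      <= sqnorm_of (z 0%N - p) - sqnorm_of (z n - p).
    by move=> /le_trans; apply; rewrite lerBlDr lerDl (coercive_sqnorm_ge0 _ _ Pco).
  elim: n => [|n IH]; first by rewrite big_nil subrr.
  by rewrite big_nat_recr //=; have := fejer p n Tp; lra.
have [a0 Pa] := Pco.
have zK i : `|z i| <= Num.sqrt (a^-1 * sqnorm_of (z 0%N - p)) + `|p|.
  rewrite -{1}(subrK p (z i)); apply: le_trans (ler_normD _ _) _; rewrite lerD2r.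
  rewrite -[leLHS]normr_id -sqrtr_sqr ler_sqrt; last first.
    by rewrite mulr_ge0 ?invr_ge0 ?(ltW a0) // (coercive_sqnorm_ge0 _ _ Pco).
  by rewrite ler_pdivlMl //; apply: le_trans (Pa _) (bnd _ _ Tp).
apply: (opial _ _ (fun x => T x = x) _ Psa Pco zK) => [q Tq|U x UU sU zx].
  exists (lim (sqnorm_of (z i - q) @[i --> \oo])).
  apply: nonincreasing_is_cvgn.
    apply/nonincreasing_seqP => i; apply: le_trans (fejer q i Tq) _.
    by rewrite lerBlDr lerDl mulr_ge0 // (coercive_sqnorm_ge0 _ _ Pco).
  exists 0 => _ [i _ <-]; exact: coercive_sqnorm_ge0 Pco.
apply: (demiclosed _ _ _ _ _ _ Psa Pco PB Tfirm zK zx).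
by move=> A /Dcvg; apply: sU.
Qed.

End krasnoselskii_mann.

(** * The forward-backward operator *)

Section forward_backward.
Context {R : realType} {Z : hilbertType R}.

Lemma ler_opnorm (Q : {linear Z -> Z}) x :
  bounded_near Q (nbhs (0 : Z)) -> `|Q x| <= opnorm Q * `|x|.
Proof.
move=> /linear_boundedP Qbd.
have [r [r0 Qr]] : exists r : R, 0 <= r /\ forall x, `|Q x| <= r * `|x|.
  have [r [r0 Qr]] := filter_ex (filterI (nbhs_pinfty_gt (num_real (0 : R))) Qbd).
  by exists r; split=> //; apply: ltW.
have [->|x0] := eqVneq x 0; first by rewrite linear0 !normr0 mulr0.
have nx0 : 0 < `|x| by rewrite normr_gt0.
rewrite -ler_pdivrMr // mulrC.
have -> : `|x|^-1 * `|Q x| = `|Q (`|x|^-1 *: x)|.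
  by rewrite linearZ normrZ normfV normr_id.
apply: ub_le_sup.
  exists r => _ [y /= y1 <-]; apply: le_trans (Qr y) _.
  by rewrite ler_piMr.
by exists (`|x|^-1 *: x) => //=; rewrite normrZ normfV normr_id mulVf ?gt_eqF.
Qed.

Definition fb_metric (g : R) (Q : {linear Z -> Z}) : {linear Z -> Z} :=
  idfun \- g \*: Q.

Definition fb_step (g : R) (M : Z -> set Z) (C : Z -> Z) (x : Z) : Z :=
  resolvent g M (x - g *: C x).

Lemma fb_metric_self_adjoint g (Q : {linear Z -> Z}) :
  self_adjoint Q -> self_adjoint (fb_metric g Q).
Proof. by move=> Qsa x y; rewrite /= !innerE Qsa. Qed.

Lemma fb_metric_coercive g (Q : {linear Z -> Z}) :
  bounded_near Q (nbhs (0 : Z)) -> 0 <= g -> g * opnorm Q < 1 ->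
  coercive (fb_metric g Q) (1 - g * opnorm Q).
Proof.
move=> Qbd g0 gQ; split; first by rewrite subr_gt0.
move=> x; rewrite /sqnorm_of /= innerDr innerNr innerZr inner_normE mulrBl mul1r.
rewrite lerD2l lerN2 -mulrA ler_wpM2l //; apply: le_trans (inner_le_norm _ _) _.
by rewrite expr2 mulrCA ler_wpM2l // ler_opnorm.
Qed.

Lemma fb_metric_bounded g (Q : {linear Z -> Z}) x :
  bounded_near Q (nbhs (0 : Z)) -> 0 <= g ->
  `|fb_metric g Q x| <= (1 + g * opnorm Q) * `|x|.
Proof.
move=> Qbd g0; rewrite /= mulrDl mul1r; apply: le_trans (ler_normB _ _) _.
by rewrite lerD2l normrZ ger0_norm // -mulrA ler_wpM2l // ler_opnorm.
Qed.

(** The inclusion defining the resolvent, with the forward step [g C x] moved to the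
other side. *)
Lemma fb_stepP g M C x : maximally_monotone M -> 0 < g ->
  exists2 u, M (fb_step g M C x) u & g *: (u + C x) = x - fb_step g M C x.
Proof.
move=> hM g0; have [u Mu e] := resolventP M g (x - g *: C x) hM g0.
exists u => //; rewrite scalerDr -/(fb_step g M C x) in e *.
by apply/eqP; rewrite eq_sym subr_eq addrAC e subrK.
Qed.

(** The [P]-image of the residual difference is [g] times a difference of values of
[M + C] at the images: the part [C x - C y] of [fb_stepP] turns into
[C (T x) - C (T y)] because [C] is affine with linear part [Q]. Both summands
[u - v] and [Q (p - q)] pair nonnegatively with [p - q]. *)
Lemma fb_step_firmly_nonexpansive g M (Q : {linear Z -> Z}) c C :
  maximally_monotone M -> positive_op Q -> (forall z, C z = Q z + c) -> 0 < g ->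
  firmly_nonexpansive_of (fb_metric g Q) (fb_step g M C).
Proof.
move=> hM Qpos hC g0 x y.
have [u Mu eu] := fb_stepP g M C x hM g0.
have [v Mv ev] := fb_stepP g M C y hM g0.
move: (fb_step g M C x) (fb_step g M C y) Mu Mv eu ev => p q Mu Mv eu ev.
pose d := x - p - (y - q).
have dE : d = g *: (u - v + Q (x - y)).
  rewrite /d -eu -ev -scalerBr !hC (linearB Q); congr (_ *: _).
  rewrite opprD addrACA; congr (_ + _).
  by rewrite opprD addrACA subrr addr0.
have Qxy : Q (x - y) = Q d + Q (p - q).
  rewrite -linearD; congr (Q _).
  have -> : d = (x - y) - (p - q) by rewrite /d !opprD addrACA.
  by rewrite subrK.
have -> : fb_metric g Q d = g *: (u - v + Q (p - q)).
  rewrite /= {1}dE -scalerBr Qxy; congr (_ *: _).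
  by rewrite [Q d + _]addrC addrA addrK.
by rewrite innerZr innerDr mulr_ge0 ?(ltW g0) // addr_ge0 // hM.1.
Qed.

Lemma fb_step_fixed g M C x : maximally_monotone M -> 0 < g ->
  fb_step g M C x = x <-> op_zeros (op_add M (op_single C)) x.
Proof.
move=> hM g0; have [v Mv ev] := fb_stepP g M C x hM g0; split.
  move=> fx; rewrite fx subrr in ev Mv; exists v => //; exists (C x) => //.
  by move/eqP: ev; rewrite scaler_eq0 gt_eqF //= => /eqP.
move=> [u Mu [_ -> uC]].
have Cx : C x = - u by apply/eqP; rewrite -addr_eq0 addrC uC.
apply/esym/subr0_eq/inner_le0_eq0.
rewrite -{2}ev (_ : v + C x = - (u - v)); last by rewrite Cx opprB.
rewrite scalerN innerNr innerZr oppr_le0 mulr_ge0 ?(ltW g0) //.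
exact: hM.1 Mu Mv.
Qed.

End forward_backward.

Theorem theorem3p4 (R : realType) (Z : hilbertType R)
    (M : Z -> set Z) (hM : maximally_monotone M)
    (Q : {linear Z -> Z}) (Qbounded : bounded_near Q (nbhs (0 : Z)))
    (Qsa : self_adjoint Q) (Qpos : positive_op Q)
    (Qneq0 : exists z, Q z != 0)
    (c : Z) (C : Z -> Z) (hC : forall z, C z = Q z + c)
    (hsol : op_zeros (op_add M (op_single C)) !=set0)
    (xi : R) (hxi : xi = 1 / opnorm Q)
    (z0 : Z) (gamma : R) (hgamma : 0 < gamma < xi)
    (rho : nat -> R) (hrho : forall i, 0 <= rho i <= 2)
    (hrho_sum : (\sum_(0 <= i <oo) (rho i * (2 - rho i))%:E = +oo)%E)
    (z zhalf : nat -> Z) (hz0 : z 0%N = z0)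
    (hzhalf : forall i, zhalf i = resolvent gamma M (z i - gamma *: C (z i)))
    (hz : forall i, z i.+1 = z i + rho i *: (zhalf i - z i)) :
  exists2 x, op_zeros (op_add M (op_single C)) x & weakly_converges z x.
Proof.
move: hgamma; rewrite hxi div1r => /andP[g0 gxi].
have Q0 : 0 < opnorm Q by rewrite -invr_gt0; apply: lt_trans g0 gxi.
have gQ : gamma * opnorm Q < 1 by rewrite -ltr_pdivlMr // div1r.
have [x Tx zx] : exists2 x, fb_step gamma M C x = x & weakly_converges z x.
  apply: (krasnoselskii_mann (fb_metric gamma Q) (1 - gamma * opnorm Q)
    (1 + gamma * opnorm Q) _ rho).
  - exact: fb_metric_self_adjoint.
  - by apply: fb_metric_coercive => //; apply: ltW.
  - by move=> y; apply: fb_metric_bounded => //; apply: ltW.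
  - exact: fb_step_firmly_nonexpansive hC g0.
  - by have [p zp] := hsol; exists p; apply/fb_step_fixed.
  - exact: hrho.
  - exact: hrho_sum.
  - by move=> i; rewrite hz hzhalf.
by exists x => //; apply/(fb_step_fixed gamma M C x hM g0).
Qed.
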